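(* Let $\Lambda\subset(0,\infty)$ be finite or countable. The product of morphisms in $\mathcal K_\Lambda$ is associative: for any nonempty finite ultrametric spaces $X,Y,Z,U$ whose spectra are contained in $\Lambda$ and any morphisms $\mathfrak p:X\to Y$, $\mathfrak q:Y\to Z$, $\mathfrak r:Z\to U$ we have $$(\mathfrak r\diamond\mathfrak q)\diamond\mathfrak p=\mathfrak r\diamond(\mathfrak q\diamond\mathfrak p).$$
   Context: An ultrametric space is a metric space with $d(x,z)\le\max(d(x,y),d(y,z))$; its spectrum is its set of nonzero distances. A morphism $\mathfrak p:X\to Y$ of $\mathcal K_\Lambda$ between nonempty finite ultrametric spaces with spectra in $\Lambda$ is a triple $(P,p_+,p_-)$, where $P$ is an ultrametric space with spectrum in $\Lambda$, and $p_+:X\to P$, $p_-:Y\to P$ are isometric embeddings with $p_+(X)\cup p_-(Y)=P$. Two triples $(P,p_\pm)$, $(P',p'_\pm)$ are regarded as equal if there is a bijective isometry $\pi:P\to P'$ with $p'_\pm=\pi\circ p_\pm$. Product of $\mathfrak p=(P,p_+,p_-):X\to Y$ and $\mathfrak q=(Q,q_+,q_-):Y\to Z$: glue $P\sqcup Q$ by identifying $p_-(y)\sim q_+(y)$ for all $y\in Y$; on the resulting set $P\Join Q$ keep the metrics of $P$ and $Q$, and for $a\in P\setminus p_-(Y)$, $b\in Q\setminus q_+(Y)$ put $d(a,b)=\min_{y\in Y}\max(d_P(a,p_-(y)),d_Q(q_+(y),b))$ (this is an ultrametric). Then $\mathfrak q\diamond\mathfrak p:X\to Z$ is $(R,p_+,q_-)$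 with $R=p_+(X)\cup q_-(Z)\subset P\Join Q$. *)

(* Defs.v *)
From HB Require Import structures.
From mathcomp Require Import all_boot all_order all_algebra.
From mathcomp Require Import boolp classical_sets functions cardinality reals.
From mathcomp Require Import topology.

Set Implicit Arguments.
Unset Strict Implicit.
Unset Printing Implicit Defensive.

Import Order.TTheory GRing.Theory Num.Theory.

Local Open Scope classical_set_scope.
Local Open Scope ring_scope.
Local Open Scope quotient_scope.

HB.mixin Record Metric_isUltrametric (R : realType) T & Metric R T := {
  ultrametric_triangle : forall x y z : T,
    mdist x z <= Num.max (mdist x y) (mdist y z)
}.

#[short(type="ultrametricType")]
HB.structure Definition Ultrametric (R : realType) :=
  { T of Metric R T & Metric_isUltrametric R T }.

#[short(type="finUltrametricType")]
HB.structure Definition FinUltrametric (R : realType) :=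
  { T of Ultrametric R T & Finite T }.

Definition spectrum (R : realType) (T : metricType R) : set R :=
  [set r | r != 0 /\ exists x y : T, r = mdist x y].

Definition isometry (R : realType) (S T : metricType R) (f : S -> T) : Prop :=
  forall x y : S, mdist (f x) (f y) = mdist x y.

Lemma isometry_inj (R : realType) (S T : metricType R) (f : S -> T) :
  isometry f -> injective f.
Proof.
by move=> fi x y fxy; apply: mdist_positivity; rewrite -fi fxy mdistxx.
Qed.

Record kobj (R : realType) (Lambda : set R) := KObj {
  kobj_space :> finUltrametricType R;
  kobj_neq0 : (0 < #|kobj_space|)%N;
  kobj_spectrum : spectrum kobj_space `<=` Lambda
}.

(* Triples (P, p_+, p_-) representing the morphisms X -> Y of K_Lambda;
   two triples denote the same morphism when they are related by [kmor_eq]. *)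
Record kmor (R : realType) (Lambda : set R) (X Y : kobj Lambda) := KMor {
  kmor_space :> ultrametricType R;
  kmor_spectrum : spectrum kmor_space `<=` Lambda;
  kplus : X -> kmor_space;
  kminus : Y -> kmor_space;
  kplus_isometry : isometry kplus;
  kminus_isometry : isometry kminus;
  kmor_cover : range kplus `|` range kminus = [set: kmor_space]
}.

Definition kmor_eq (R : realType) (Lambda : set R) (X Y : kobj Lambda)
    (p p' : kmor X Y) : Prop :=
  exists pi : p -> p', [/\ bijective pi, isometry pi,
    kplus p' =1 pi \o @kplus _ _ _ _ p & kminus p' =1 pi \o @kminus _ _ _ _ p].

Lemma kmor_eq_refl (R : realType) (Lambda : set R) (X Y : kobj Lambda)
  (p : kmor X Y) : kmor_eq p p.
Proof. by exists id; split=> //; exists id. Qed.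

Lemma kmor_eq_sym (R : realType) (Lambda : set R) (X Y : kobj Lambda)
  (p q : kmor X Y) : kmor_eq p q -> kmor_eq q p.
Proof.
move=> [f [[g fK gK] fi fp fm]]; exists g; split.
- by exists f.
- by move=> x y; rewrite -fi !gK.
- by move=> x /=; rewrite fp /= fK.
- by move=> x /=; rewrite fm /= fK.
Qed.

Lemma kmor_eq_trans (R : realType) (Lambda : set R) (X Y : kobj Lambda)
  (p q r : kmor X Y) : kmor_eq p q -> kmor_eq q r -> kmor_eq p r.
Proof.
move=> [f [fb fi fp fm]] [g [gb gi gp gm]]; exists (g \o f); split.
- exact: bij_comp.
- by move=> x y /=; rewrite gi fi.
- by move=> x /=; rewrite gp /= fp.
- by move=> x /=; rewrite gm /= fm.
Qed.

(* A subset of an ultrametric space with the restricted metric.  The alias is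
   needed because the library only equips [set_type A] with a pseudometric. *)
Definition subspace_of (R : realType) (T : ultrametricType R) (A : set T) :=
  set_type A.

Section subspace_of.
Context (R : realType) (T : ultrametricType R) (A : set T).
Local Notation S := (subspace_of A).

HB.instance Definition _ := SubChoice.on S.

Let sdist (x y : S) : R := mdist (val x) (val y).

Let sdistxx x : sdist x x = 0. Proof. exact: mdistxx. Qed.

Let sdist_positivity x y : sdist x y = 0 -> x = y.
Proof. by move=> /mdist_positivity /val_inj. Qed.

Let sdist_sym x y : sdist x y = sdist y x. Proof. exact: metric_sym. Qed.

Let sdist_triangle y x z : sdist x z <= sdist x y + sdist y z.
Proof. exact: metric_triangle. Qed.

HB.instance Definition _ := isMetric.Build R S
  sdistxx sdist_positivity sdist_sym sdist_triangle.

Let sdist_ultra (x y z : S) : mdist x z <= Num.max (mdist x y) (mdist y z).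
Proof. exact: (ultrametric_triangle (val x) (val y) (val z)). Qed.

HB.instance Definition _ := Metric_isUltrametric.Build R S sdist_ultra.

Lemma mdist_subspace_of (x y : S) : mdist x y = mdist (val x) (val y).
Proof. by []. Qed.

End subspace_of.

Section glue.
Context (R : realType) (Lambda : set R) (X Y Z : kobj Lambda).
Context (q : kmor Y Z) (p : kmor X Y).

Let y0 : Y := enum_val (Ordinal (kobj_neq0 Y)).

(* The equivalence relation on the disjoint union of P and Q generated by
   p_-(y) ~ q_+(y): since p_- and q_+ are injective, its reflexive symmetric
   closure is already transitive. *)
Definition glue_rel : rel (p + q) := fun u v =>
  `[< match u, v with
      | inl a, inl a' => a = a'
      | inr b, inr b' => b = b'
      | inl a, inr b | inr b, inl a =>
          exists y, a = kminus p y /\ b = kplus q y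
      end >].

Let glue_rel_refl : reflexive glue_rel.
Proof. by move=> [a|b]; apply/asboolP. Qed.

Let glue_rel_sym : symmetric glue_rel.
Proof.
by move=> [a|b] [a'|b']; apply: asbool_equiv_eq.
Qed.

Let glue_rel_trans : transitive glue_rel.
Proof.
move=> [a|b] [a'|b'] [a''|b''] /asboolP h1 /asboolP h2; apply/asboolP;
  move: h1 h2.
- by move=> -> ->.
- by move=> ->.
- by move=> + <-.
- move=> [y [-> ->]] [y' []].
  by move=> /(isometry_inj (@kminus_isometry _ _ _ _ p)) -> ->.
- move=> [y [-> ->]] [y' [->]].
  by move=> /(isometry_inj (@kplus_isometry _ _ _ _ q)) ->.
- by move=> + <-.
- by move=> ->.
- by move=> -> ->.
Qed.

Canonical glue_equiv :=
  EquivRel glue_rel glue_rel_refl glue_rel_sym glue_rel_trans.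

Definition glue : Type := {eq_quot glue_rel}.

HB.instance Definition _ := Choice.on glue.
HB.instance Definition _ := EqQuotient.on glue.

Definition via (a : p) (b : q) (y : Y) : R :=
  Num.max (mdist a (kminus p y)) (mdist (kplus q y) b).

Definition bridge (a : p) (b : q) : R :=
  via a b [arg min_(y < y0) via a b y]%O.

(* The formula d(a,b) = min_y max(d(a,p_-(y)), d(q_+(y),b)) is only needed for a
   and b outside the image of Y.  It is imposed for all a and b: otherwise it
   gives the distance in P or Q, so the function descends to the quotient (see
   [glue_rel_dist]). *)
Definition sum_dist (u v : p + q) : R :=
  match u, v with
  | inl a, inl a' => mdist a a'
  | inr b, inr b' => mdist b b'
  | inl a, inr b | inr b, inl a => bridge a b
  end.

Lemma bridge_le a b y : bridge a b <= via a b y.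
Proof. by rewrite /bridge; case: arg_minP => // i _; apply. Qed.

Lemma bridge_min a b : exists y, bridge a b = via a b y.
Proof. by rewrite /bridge; eexists. Qed.

Lemma sum_dist_sym u v : sum_dist u v = sum_dist v u.
Proof. by case: u v => [a|b] [a'|b'] //=; exact: metric_sym. Qed.

Lemma sum_dist_ge0 u v : 0 <= sum_dist u v.
Proof.
by case: u v => [a|b] [a'|b'] /=; rewrite ?mdist_ge0 // /bridge /via le_max
  mdist_ge0.
Qed.

Let kK y y' :
  mdist (kminus p y) (kminus p y') = mdist (kplus q y) (kplus q y').
Proof. by rewrite kminus_isometry kplus_isometry. Qed.

Let step (T : ultrametricType R) (y x z : T) (r : R) :
  mdist x y <= r -> mdist y z <= r -> mdist x z <= r.
Proof.
by move=> h1 h2; apply: le_trans (ultrametric_triangle x y z) _;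
  rewrite ge_max h1.
Qed.

Lemma sum_dist_ultra u v w :
  sum_dist u w <= Num.max (sum_dist u v) (sum_dist v w).
Proof.
have viaL a b y : mdist a (kminus p y) <= via a b y by rewrite le_max lexx.
have viaR a b y : mdist (kplus q y) b <= via a b y.
  by rewrite le_max lexx orbT.
have M1 (x y : R) : x <= Num.max x y by rewrite le_max lexx.
have M2 (x y : R) : y <= Num.max x y by rewrite le_max lexx orbT.
case: u v w => [a|b] [a'|b'] [a''|b''] /=; try exact: ultrametric_triangle.
- have [y ->] := bridge_min a' b''.
  apply: le_trans (bridge_le _ _ y) _; rewrite {1}/via ge_max; apply/andP; split.
    exact: step (M1 _ _) (le_trans (viaL _ _ _) (M2 _ _)).
  exact: le_trans (viaR _ _ _) (M2 _ _).
- have [y ->] := bridge_min a b'; have [y' ->] := bridge_min a'' b'.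
  apply: (@step _ (kminus p y)).
    exact: le_trans (viaL _ _ _) (M1 _ _).
  apply: (@step _ (kminus p y')); last first.
    by rewrite metric_sym; exact: le_trans (viaL _ _ _) (M2 _ _).
  rewrite kK; apply: (@step _ b').
    exact: le_trans (viaR _ _ _) (M1 _ _).
  by rewrite metric_sym; exact: le_trans (viaR _ _ _) (M2 _ _).
- have [y ->] := bridge_min a b'.
  apply: le_trans (bridge_le _ _ y) _; rewrite {1}/via ge_max; apply/andP; split.
    exact: le_trans (viaL _ _ _) (M1 _ _).
  exact: step (le_trans (viaR _ _ _) (M1 _ _)) (M2 _ _).
- have [y ->] := bridge_min a' b.
  apply: le_trans (bridge_le _ _ y) _; rewrite {1}/via ge_max; apply/andP; split.
    apply: (@step _ a'); last exact: le_trans (viaL _ _ _) (M1 _ _).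
    by rewrite metric_sym; exact: M2.
  exact: le_trans (viaR _ _ _) (M1 _ _).
- have [y ->] := bridge_min a' b; have [y' ->] := bridge_min a' b''.
  apply: (@step _ (kplus q y)).
    by rewrite metric_sym; exact: le_trans (viaR _ _ _) (M1 _ _).
  apply: (@step _ (kplus q y')); last first.
    exact: le_trans (viaR _ _ _) (M2 _ _).
  rewrite -kK; apply: (@step _ a').
    by rewrite metric_sym; exact: le_trans (viaL _ _ _) (M1 _ _).
  exact: le_trans (viaL _ _ _) (M2 _ _).
- have [y ->] := bridge_min a'' b'.
  apply: le_trans (bridge_le _ _ y) _; rewrite {1}/via ge_max; apply/andP; split.
    exact: le_trans (viaL _ _ _) (M2 _ _).
  apply: (@step _ b'); first exact: le_trans (viaR _ _ _) (M2 _ _).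
  by rewrite metric_sym; exact: M1.
Qed.

Lemma sum_dist_eq0 u v : (sum_dist u v == 0) = glue_rel u v.
Proof.
apply/eqP/asboolP; case: u v => [a|b] [a'|b'] /=.
- exact: mdist_positivity.
- have [y ->] := bridge_min a b' => /eqP; rewrite eq_le ge_max => /andP[/andP[]].
  move=> h1 h2 _; exists y; split.
    by apply: mdist_positivity; apply/eqP; rewrite eq_le h1 mdist_ge0.
  by apply/esym/mdist_positivity; apply/eqP; rewrite eq_le h2 mdist_ge0.
- have [y ->] := bridge_min a' b => /eqP; rewrite eq_le ge_max => /andP[/andP[]].
  move=> h1 h2 _; exists y; split.
    by apply: mdist_positivity; apply/eqP; rewrite eq_le h1 mdist_ge0.
  by apply/esym/mdist_positivity; apply/eqP; rewrite eq_le h2 mdist_ge0.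
- exact: mdist_positivity.
- by move=> ->; rewrite mdistxx.
- move=> [y [-> ->]]; apply/eqP; rewrite eq_le (sum_dist_ge0 (inl _) (inr _)).
  by rewrite (le_trans (bridge_le _ _ y)) // /via !mdistxx maxxx.
- move=> [y [-> ->]]; apply/eqP; rewrite eq_le (sum_dist_ge0 (inl _) (inr _)).
  by rewrite (le_trans (bridge_le _ _ y)) // /via !mdistxx maxxx.
- by move=> ->; rewrite mdistxx.
Qed.

Lemma glue_rel_dist u u' v v' :
  glue_rel u u' -> glue_rel v v' -> sum_dist u v = sum_dist u' v'.
Proof.
have H s s' t t' : glue_rel s s' -> glue_rel t t' ->
    sum_dist s t <= sum_dist s' t'.
  rewrite -!sum_dist_eq0 => /eqP s0 /eqP t0.
  apply: le_trans (sum_dist_ultra s s' t) _.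
  rewrite s0 ge_max sum_dist_ge0 /=.
  apply: le_trans (sum_dist_ultra s' t' t) _.
  by rewrite (sum_dist_sym t') t0 ge_max lexx sum_dist_ge0.
move=> uu vv; apply/eqP; rewrite eq_le !H //; by rewrite glue_rel_sym.
Qed.

Let gdist (x y : glue) : R := sum_dist (repr x) (repr y).

Let gdistxx x : gdist x x = 0.
Proof. by apply/eqP; rewrite sum_dist_eq0 glue_rel_refl. Qed.

Let gdist_positivity x y : gdist x y = 0 -> x = y.
Proof.
move=> /eqP; rewrite sum_dist_eq0 => h.
by rewrite -[x]reprK -[y]reprK; apply/eqmodP.
Qed.

Let gdist_sym x y : gdist x y = gdist y x. Proof. exact: sum_dist_sym. Qed.

Let gdist_triangle y x z : gdist x z <= gdist x y + gdist y z.
Proof.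
apply: le_trans (sum_dist_ultra _ (repr y) _) _.
by rewrite ge_max lerDl lerDr !sum_dist_ge0.
Qed.

HB.instance Definition _ := isMetric.Build R glue
  gdistxx gdist_positivity gdist_sym gdist_triangle.

Let gdist_ultra (x y z : glue) : mdist x z <= Num.max (mdist x y) (mdist y z).
Proof. exact: sum_dist_ultra. Qed.

HB.instance Definition _ := Metric_isUltrametric.Build R glue gdist_ultra.

Definition glue_inl (a : p) : glue := \pi_glue (inl a).
Definition glue_inr (b : q) : glue := \pi_glue (inr b).

Lemma mdist_glue_pi u v : mdist (\pi_glue u) (\pi_glue v) = sum_dist u v.
Proof.
by apply: glue_rel_dist; apply/eqmodP; rewrite reprK.
Qed.

Lemma glue_identify y : glue_inl (kminus p y) = glue_inr (kplus q y).
Proof. by apply/eqmodP/asboolP; exists y. Qed.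

Lemma mdist_glue_inl : isometry glue_inl.
Proof. by move=> a a'; rewrite mdist_glue_pi. Qed.

Lemma mdist_glue_inr : isometry glue_inr.
Proof. by move=> b b'; rewrite mdist_glue_pi. Qed.

Lemma mdist_glue_inlr a b : mdist (glue_inl a) (glue_inr b) = bridge a b.
Proof. by rewrite mdist_glue_pi. Qed.

Lemma spectrum_glue : spectrum glue `<=` Lambda.
Proof.
have sp (s : p + q) t : sum_dist s t != 0 -> Lambda (sum_dist s t).
  case: s t => [a|b] [a'|b'] /= h.
  - by apply: (@kmor_spectrum _ _ _ _ p); split => //; exists a, a'.
  - move: h; have [y ->] := bridge_min a b'; rewrite /via.
    case: (leP (mdist a (kminus p y))) => _ h.
      by apply: (@kmor_spectrum _ _ _ _ q); split => //; exists (kplus q y), b'.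
    by apply: (@kmor_spectrum _ _ _ _ p); split => //; exists a, (kminus p y).
  - move: h; have [y ->] := bridge_min a' b; rewrite /via.
    case: (leP (mdist a' (kminus p y))) => _ h.
      by apply: (@kmor_spectrum _ _ _ _ q); split => //; exists (kplus q y), b.
    by apply: (@kmor_spectrum _ _ _ _ p); split => //; exists a', (kminus p y).
  - by apply: (@kmor_spectrum _ _ _ _ q); split => //; exists b, b'.
by move=> r [r0 [x [y rE]]]; subst r; exact: sp.
Qed.

Definition kprod_set : set glue :=
  range (glue_inl \o kplus p) `|` range (glue_inr \o kminus q).

Lemma kprod_set_plus x : glue_inl (kplus p x) \in kprod_set.
Proof. by rewrite inE; left; exists x. Qed.

Lemma kprod_set_minus z : glue_inr (kminus q z) \in kprod_set.
Proof. by rewrite inE; right; exists z. Qed.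

Definition kprod_space : ultrametricType R := subspace_of kprod_set.

Definition kprod_plus (x : X) : kprod_space := 
  exist (fun g => g \in kprod_set) _ (kprod_set_plus x).
Definition kprod_minus (z : Z) : kprod_space := 
  exist (fun g => g \in kprod_set) _ (kprod_set_minus z).

Lemma spectrum_kprod : spectrum kprod_space `<=` Lambda.
Proof.
move=> r [r0 [x [y rE]]]; apply: spectrum_glue; split => //.
by exists (val x), (val y).
Qed.

Lemma kprod_plus_isometry : isometry kprod_plus.
Proof. by move=> x y; rewrite mdist_subspace_of mdist_glue_inl kplus_isometry. Qed.

Lemma kprod_minus_isometry : isometry kprod_minus.
Proof.
by move=> x y; rewrite mdist_subspace_of mdist_glue_inr kminus_isometry.
Qed.

Lemma kprod_cover : range kprod_plus `|` range kprod_minus = [set: kprod_space].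
Proof.
apply/seteqP; split => // -[g gP] _; have /set_mem[[x _ xg]|[z _ zg]] := gP.
  by left; exists x => //; apply: val_inj.
by right; exists z => //; apply: val_inj.
Qed.

Definition kprod : kmor X Z :=
  KMor spectrum_kprod kprod_plus_isometry kprod_minus_isometry kprod_cover.

End glue.

Notation "q ⋄ p" := (kprod q p) (at level 40, left associativity).

(* Main.v *)
(** A morphism [p : X -> Y] is determined by the cross distances
    [d(p_+ x, p_- y)], because [p_+] and [p_-] are isometric and jointly
    surjective.  On cross distances the product is the matrix product of the
    (min, max) semiring, and both bracketings have cross distance
    [min_(y, z) max(d(x, y), d(y, z), d(z, u))].  Minima are handled through
    their sublevel sets: [d(x, z) <= t] iff [d(x, y) <= t] and [d(y, z) <= t]
    for some [y]. *)
Require Import Defs.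
From mathcomp Require Import all_boot all_order all_algebra.
From mathcomp Require Import boolp classical_sets functions cardinality reals.
From mathcomp Require Import topology.

Local Open Scope classical_set_scope.
Local Open Scope ring_scope.

Import Order.TTheory.

Definition cross_dist {R : realType} {Lambda : set R} {X Y : kobj Lambda}
    (p : kmor X Y) (x : X) (y : Y) : R :=
  mdist (kplus p x) (kminus p y).

(** The index type [X + Y] does not depend on [p], so points of two morphisms can be matched by
    index. *)
Definition kmor_pt {R : realType} {Lambda : set R} {X Y : kobj Lambda}
    (p : kmor X Y) (w : X + Y) : p :=
  match w with inl x => kplus p x | inr y => kminus p y end.

Lemma kmor_pt_surj {R : realType} {Lambda : set R} {X Y : kobj Lambda}
    (p : kmor X Y) (a : p) :
  exists w, kmor_pt p w = a.
Proof.
have : [set: p] a by [].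
rewrite -(kmor_cover p) => -[[x _ <-]|[y _ <-]]; first by exists (inl x).
by exists (inr y).
Qed.

Lemma eq_kmor_pt_dist {R : realType} {Lambda : set R} {X Y : kobj Lambda}
    (p p' : kmor X Y) :
  (forall x y, cross_dist p x y = cross_dist p' x y) ->
  forall w w', mdist (kmor_pt p w) (kmor_pt p w') =
               mdist (kmor_pt p' w) (kmor_pt p' w').
Proof.
move=> pp' [x|y] [x'|y'] /=.
- by rewrite !kplus_isometry.
- exact: pp'.
- rewrite metric_sym [RHS]metric_sym; exact: pp'.
- by rewrite !kminus_isometry.
Qed.

Lemma cross_dist_kmor_eq {R : realType} {Lambda : set R} {X Y : kobj Lambda}
    (p p' : kmor X Y) :
  (forall x y, cross_dist p x y = cross_dist p' x y) -> kmor_eq p p'.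
Proof.
move=> /eq_kmor_pt_dist pp'.
have [s sK] := choice (kmor_pt_surj p).
have [s' s'K] := choice (kmor_pt_surj p').
(* The choice of index is harmless: two indices of one point of [p] are at distance 0 there, hence
   also in [p']. *)
have ptE w : kmor_pt p' (s (kmor_pt p w)) = kmor_pt p' w.
  by apply: mdist_positivity; rewrite -pp' sK mdistxx.
have ptE' w : kmor_pt p (s' (kmor_pt p' w)) = kmor_pt p w.
  by apply: mdist_positivity; rewrite pp' s'K mdistxx.
exists (fun a => kmor_pt p' (s a)); split.
- exists (fun a => kmor_pt p (s' a)) => a; first by rewrite ptE' sK.
  by rewrite ptE s'K.
- by move=> a b; rewrite -pp' !sK.
- by move=> x; rewrite /= (ptE (inl x)).
- by move=> y; rewrite /= (ptE (inr y)).
Qed.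

Lemma cross_dist_kprod_le {R : realType} {Lambda : set R} {X Y Z : kobj Lambda}
    (p : kmor X Y) (q : kmor Y Z) (x : X) (z : Z) (t : R) :
  cross_dist (q ⋄ p) x z <= t <->
  exists2 y, cross_dist p x y <= t & cross_dist q y z <= t.
Proof.
rewrite /cross_dist mdist_subspace_of mdist_glue_inlr; split.
  (* The minimum is attained, and a minimiser is the witness. *)
  have [y ->] := bridge_min (kplus p x) (kminus q z).
  by rewrite ge_max => /andP[]; exists y.
move=> [y pt qt]; apply: le_trans (bridge_le _ _ y) _.
by rewrite ge_max pt.
Qed.

Theorem lemma1p2 (R : realType) (Lambda : set R)
    (Lambda_gt0 : Lambda `<=` [set l | 0 < l])
    (Lambda_countable : countable Lambda)
    (X Y Z U : kobj Lambda)
    (p : kmor X Y) (q : kmor Y Z) (r : kmor Z U) :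
  kmor_eq ((r ⋄ q) ⋄ p) (r ⋄ (q ⋄ p)).
Proof.
apply: cross_dist_kmor_eq => x u; apply/eqP; rewrite eq_le; apply/andP; split.
(* Taking the right-hand distance itself as the level [t] yields [y] and [z], which also bound the
   other bracketing. *)
- have /cross_dist_kprod_le[z /cross_dist_kprod_le[y py qy] rz] :=
    lexx (cross_dist (r ⋄ (q ⋄ p)) x u).
  by apply/cross_dist_kprod_le; exists y => //; apply/cross_dist_kprod_le; exists z.
- have /cross_dist_kprod_le[y py /cross_dist_kprod_le[z qz rz]] :=
    lexx (cross_dist ((r ⋄ q) ⋄ p) x u).
  by apply/cross_dist_kprod_le; exists z => //; apply/cross_dist_kprod_le; exists y.
Qed.
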